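(* Let a prior network with boundary conditions, positive weights $d_{kl}$ and a material amount $K>0$ be given. Let $(\kappa_{kl})$ be a physical network with $\sum_{k>l,\langle k,l\rangle=1}\kappa_{kl}^{1/2}d_{kl}=K$ that globally minimizes the complementary dissipation $$f=\sum_{k>l,\langle k,l\rangle=1}\frac{Q_{kl}^2}{\kappa_{kl}}-2\sum_{k\in\mathcal P}\bar p_k\sum_{l:\langle k,l\rangle=1}Q_{kl}$$ among all physical networks satisfying this material constraint, where $Q_{kl}$ denotes the Kirchhoff flow of the network. Then, unless $Q_{kl}=0$ for all $\langle k,l\rangle=1$, there is no path connecting two distinct pressure vertices $k,k'\in\mathcal P$ with the same prescribed pressure $\bar p_k=\bar p_{k'}$.
   Context: Prior network: a finite simple undirected graph on vertices $1,\dots,V$ with at least one edge; $\langle k,l\rangle=1$ means $k,l$ are joined by an edge ($\langle k,l\rangle=\langle l,k\rangle$), and $\langle k,l\rangle=0$ otherwise. Each edge carries a fixed weight $d_{kl}=d_{lk}>0$. Boundary conditions: disjoint vertex sets $\mathcal P$ (pressure vertices, each with prescribed pressure $\bar p_k\in\mathbb R$) and $\mathcal F$ (flow vertices, each with prescribed inflow $q_k\in\mathbb R$, $q_k\neq 0$; vertices with zero prescribed inflow are by convention not in $\mathcal F$). Put $q_k=0$ for $k\notin\mathcal P\cup\mathcal F$. A network is a choice of conductances $\kappa_{kl}=\kappa_{lk}\ge 0$ on the edges. A Kirchhoff flow is $Q_{kl}=(p_k-p_l)\kappa_{kl}$ on the edges (so $Q_{kl}=-Q_{lk}$), where the pressures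 $p_k$ satisfy $p_k=\bar p_k$ for $k\in\mathcal P$ and $\sum_{l:\langle k,l\rangle=1}(p_k-p_l)\kappa_{kl}=q_k$ for $k\notin\mathcal P$. The network is physical if there is exactly one Kirchhoff flow (equivalently, every connected component of the subgraph of edges with $\kappa_{kl}>0$ contains a vertex of $\mathcal P$ or has total prescribed inflow zero). Convention: a term $Q_{kl}^2/\kappa_{kl}$ with $\kappa_{kl}=0$ and $Q_{kl}=0$ is $0$. A path between vertices $k$ and $l$ is a sequence of pairwise distinct vertices $k=k_1,k_2,\dots,k_n=l$ with $\langle k_i,k_{i+1}\rangle=1$ and $\kappa_{k_ik_{i+1}}>0$ for all $1\le i\le n-1$. *)

(* Defs.v *)
From HB Require Import structures.
From mathcomp Require Import all_boot all_order all_algebra.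
From mathcomp Require Import reals.

Set Implicit Arguments.
Unset Strict Implicit.
Unset Printing Implicit Defensive.

Import Order.TTheory GRing.Theory Num.Theory.
Local Open Scope ring_scope.

Record prior_network (R : realType) (V : nat) := PriorNetwork {
  adj : rel 'I_V;
  weight : 'I_V -> 'I_V -> R;
  adj_sym : symmetric adj;
  adj_irr : irreflexive adj;
  adj_nonempty : exists k l, adj k l;
  weight_sym : forall k l, adj k l -> weight k l = weight l k;
  weight_gt0 : forall k l, adj k l -> 0 < weight k l
}.

(* The values of [pbar] outside [Pset] and of [inflow] on [Pset] are never
   used below. *)
Record boundary_conditions (R : realType) (V : nat) := BoundaryConditions {
  Pset : {set 'I_V};
  Fset : {set 'I_V};
  pbar : 'I_V -> R;
  inflow : 'I_V -> R;
  PF_disjoint : [disjoint Pset & Fset];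
  inflow_neq0 : forall k, k \in Fset -> inflow k != 0;
  inflow_eq0 : forall k, k \notin Pset :|: Fset -> inflow k = 0
}.

(* Edge quantities (conductances, flows) are functions of two vertices of which
   only the values on edges are ever constrained or used. *)
Section Network.
Variables (R : realType) (V : nat).
Variables (G : prior_network R V) (B : boundary_conditions R V).
Implicit Types (kappa Q : 'I_V -> 'I_V -> R) (k l : 'I_V) (K : R).

Definition is_network kappa : Prop :=
  forall k l, adj G k l -> kappa k l = kappa l k /\ 0 <= kappa k l.

Definition kirchhoff_pressure kappa (p : 'I_V -> R) : Prop :=
  (forall k, k \in Pset B -> p k = pbar B k) /\
  (forall k, k \notin Pset B ->
     \sum_(l < V | adj G k l) (p k - p l) * kappa k l = inflow B k).

Definition kirchhoff_flow kappa Q : Prop :=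
  exists p : 'I_V -> R, kirchhoff_pressure kappa p /\
    (forall k l, adj G k l -> Q k l = (p k - p l) * kappa k l).

Definition physical kappa : Prop :=
  [/\ is_network kappa,
      exists Q, kirchhoff_flow kappa Q &
      forall Q Q', kirchhoff_flow kappa Q -> kirchhoff_flow kappa Q' ->
        forall k l, adj G k l -> Q k l = Q' k l].

Definition material kappa : R :=
  \sum_(k < V) \sum_(l < V | (l < k)%N && adj G k l)
     Num.sqrt (kappa k l) * weight G k l.

(* A Kirchhoff flow vanishes where [kappa] does; since [0 / 0 = 0] here, such
   edges contribute 0 to the first sum. *)
Definition complementary_dissipation kappa Q : R :=
  \sum_(k < V) \sum_(l < V | (l < k)%N && adj G k l) Q k l ^+ 2 / kappa k l
  - 2 * \sum_(k in Pset B) pbar B k * \sum_(l < V | adj G k l) Q k l.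

Definition global_minimizer K kappa : Prop :=
  [/\ physical kappa, material kappa = K &
      forall kappa' Q Q', physical kappa' -> material kappa' = K ->
        kirchhoff_flow kappa Q -> kirchhoff_flow kappa' Q' ->
        complementary_dissipation kappa Q <=
        complementary_dissipation kappa' Q'].

(* The path is [k :: s], its vertices being pairwise distinct. *)
Definition connecting_path kappa k l (s : seq 'I_V) : Prop :=
  [/\ path (fun i j => adj G i j && (0 < kappa i j)) k s,
      last k s = l & uniq (k :: s)].

End Network.

(* Main.v *)
Require Import Defs.
From HB Require Import structures.
From mathcomp Require Import all_boot all_order all_algebra.
From mathcomp Require Import reals.
From mathcomp Require Import ring lra.

Set Implicit Arguments.
Unset Strict Implicit.
Unset Printing Implicit Defensive.

Import Order.TTheory GRing.Theory Num.Theory.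
Local Open Scope ring_scope.

(* Every competitor has the form [kappa * r ^+ 2] with [r > 0], hence the same
   support as [kappa]. By Thomson's principle the dissipation of a competitor is
   at most that of any admissible flow [Q'] on it, so one may vary [r] and [Q']
   independently.
   Put [w = sqrt kappa * d] and [g = Q ^+ 2 / kappa]. With [Q' = Q], optimality
   in [r] gives [g = lam * w], so a nonzero flow vanishes on no conducting edge.
   A path between pressure vertices of equal pressure carries a unit flow [S]
   that does not affect the pressure term. Let [Q' = Q + eps S = Q (1 + t)] and
   [r = 1 + 2 / 3 t]. The sign of [eps] can be chosen so that
   [a = \sum w t <= 0]; then the material used is at most [K], and since
   [(1 + t) ^+ 2 / r ^+ 2 <= 1 + 2 / 3 t - t ^+ 2 / 6] the dissipation strictly
   decreases. *)

(** * Elementary estimates for finite sums *)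

Lemma small_multiplier (R : realFieldType) (I : finType) (P : pred I)
    (v : I -> R) (a : R) :
  exists h : R, [/\ 0 < h, h * a < 1 & forall i, P i -> `|h * v i| <= 1].
Proof.
have N0 : 0 <= \sum_(i | P i) `|v i| by apply: sumr_ge0.
pose D := 1 + `|a| + \sum_(i | P i) `|v i|.
have D0 : 0 < D by rewrite /D; have := normr_ge0 a; lra.
exists D^-1; split; first by rewrite invr_gt0.
  by rewrite mulrC ltr_pdivrMr // mul1r /D; have := ler_norm a; lra.
move=> i Pi; rewrite mulrC normrM normfV (gtr0_norm D0) ler_pdivrMr // mul1r /D.
rewrite (bigD1 i) //=; have := normr_ge0 a.
have : 0 <= \sum_(j | P j && (j != i)) `|v j| by apply: sumr_ge0.
lra.
Qed.

(* Moving from [r = 1] in the direction [v = g / w - lam] preserves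
   [\sum w r] and changes [\sum g / r ^+ 2] at the rate [- 2 \sum w v ^+ 2]. *)
Lemma optimal_allocation (R : realFieldType) (I : finType) (P : pred I)
    (w g : I -> R) :
  (forall i, P i -> 0 <= w i) -> (forall i, P i -> 0 <= g i) ->
  (forall i, P i -> w i = 0 -> g i = 0) -> 0 < \sum_(i | P i) w i ->
  (forall phi : R -> R, (forall i, P i -> 0 < phi (g i / w i)) ->
     \sum_(i | P i) w i * phi (g i / w i) = \sum_(i | P i) w i ->
     \sum_(i | P i) g i <= \sum_(i | P i) g i / phi (g i / w i) ^+ 2) ->
  exists lam : R, forall i, P i -> g i = lam * w i.
Proof.
move=> w0 g0 wg W0 opt.
(* Summing [g i = lam * w i] leaves only this value; it makes the total of [w i * v i] zero. *)
pose lam := (\sum_(i | P i) g i) / \sum_(i | P i) w i.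
exists lam.
pose v i := g i / w i - lam.
have wv i : P i -> w i * v i = g i - lam * w i.
  move=> Pi; rewrite /v; have [wi0|wi0] := eqVneq (w i) 0.
    by rewrite wi0 wg // !mul0r mulr0 subr0.
  by field.
have swv : \sum_(i | P i) w i * v i = 0.
  rewrite (eq_bigr _ wv) sumrB -mulr_sumr /lam divfK ?subrr //.
  by rewrite gt_eqF.
pose S := \sum_(i | P i) w i * v i ^+ 2.
pose M := \sum_(i | P i) g i * v i ^+ 2.
have gvS : \sum_(i | P i) g i * v i = S.
  have -> : S = \sum_(i | P i) (g i * v i - lam * (w i * v i)).
    by apply: eq_bigr => i Pi; rewrite expr2 mulrA wv //; have := wv i Pi; nra.
  by rewrite sumrB -mulr_sumr swv mulr0 subr0.
have wv2 i : P i -> 0 <= w i * v i ^+ 2.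
  by move=> Pi; rewrite mulr_ge0 ?w0 ?sqr_ge0.
have [Seq0|Sneq0] := eqVneq S 0.
  move=> i Pi.
  have := wv i Pi; have /eqP := psumr_eq0P wv2 Seq0 Pi; rewrite mulf_eq0 sqrf_eq0 => /orP[] /eqP ->.
    by rewrite mul0r mulr0; lra.
  by rewrite mulr0; lra.
have Spos : 0 < S by rewrite lt_neqAle eq_sym Sneq0 sumr_ge0.
(* Doubling [v] yields [x = h * v i >= - (1/2)], where [1 / (1 + x) ^+ 2 <= 1 - 2 * x + 12 * x ^+
   2]. The bound [h * (6 * M / S) < 1] makes the gain [2 * h * S] exceed the error
   [12 * h ^+ 2 * M]. *)
have [h [h0 hM hv]] := small_multiplier P (fun i => 2 * v i) (6 * M / S).
have hv2 i : P i -> - (1/2) <= h * v i.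
  by move=> Pi; have := hv i Pi; rewrite ler_norml => /andP[+ _]; lra.
have pos i : P i -> 0 < 1 + h * (g i / w i - lam).
  by move=> Pi; have := hv2 i Pi; rewrite /v; lra.
have cost : \sum_(i | P i) w i * (1 + h * (g i / w i - lam)) = \sum_(i | P i) w i.
  transitivity (\sum_(i | P i) (w i + h * (w i * v i))).
    by apply: eq_bigr => i _; rewrite /v; ring.
  by rewrite big_split /= -mulr_sumr swv mulr0 addr0.
suff: \sum_(i | P i) g i / (1 + h * (g i / w i - lam)) ^+ 2 < \sum_(i | P i) g i.
  by rewrite ltNge (opt (fun x => 1 + h * (x - lam)) pos cost).
apply: (@le_lt_trans _ _ (\sum_(i | P i)
   (g i - 2 * h * (g i * v i) + 12 * h ^+ 2 * (g i * v i ^+ 2)))).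
  apply: ler_sum => i Pi; rewrite -/(v i).
  have x0 := hv2 i Pi; set x := h * v i in x0 *.
  rewrite ler_pdivrMr ?exprn_gt0 //; last lra.
  have -> : g i - 2 * h * (g i * v i) + 12 * h ^+ 2 * (g i * v i ^+ 2) =
            g i * (1 - 2 * x + 12 * x ^+ 2) by rewrite /x; ring.
  rewrite -mulrA ler_peMr ?g0 //.
  (* This is [(1 - 2 * x + 12 * x ^+ 2) * (1 + x) ^+ 2 - 1] in factored form. *)
  have : 0 <= x ^+ 2 * ((x + 1/2) * (12 * x + 16) + 1).
    by rewrite mulr_ge0 ?sqr_ge0 // addr_ge0 // mulr_ge0; lra.
  nra.
rewrite big_split sumrB /= -!mulr_sumr gvS -/M.
move: hM; rewrite mulrA ltr_pdivrMr // mul1r => hM.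
have : 0 < h * (S - h * (6 * M)) by rewrite mulr_gt0 // subr_gt0.
nra.
Qed.

(* [1 + 2 / 3 t] is the linearization of the optimal factor
   [(1 + t) `^ (2 / 3)]. *)
Lemma perturbation_gain (R : realFieldType) (t : R) : `|t| <= 1 ->
  (1 + t) ^+ 2 / (1 + 2 / 3 * t) ^+ 2 <= 1 + 2 / 3 * t - t ^+ 2 / 6.
Proof.
rewrite ler_norml => /andP[tl tr].
rewrite ler_pdivrMr ?exprn_gt0 //; last lra.
(* Clearing the denominator leaves exactly this difference; for [|t| <= 1] the bracket is at least
   [1/54]. *)
have : 0 <= t ^+ 2 * (1/6 + 2/27 * t * (1 - t)) by rewrite mulr_ge0 ?sqr_ge0 //; nra.
nra.
Qed.

(** * Discrete calculus on the prior network *)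

Section Network.
Variables (R : realType) (V : nat).
Variables (G : prior_network R V) (B : boundary_conditions R V).
Implicit Types (kappa Q D : 'I_V -> 'I_V -> R) (x p : 'I_V -> R).

Definition edge (e : 'I_V * 'I_V) : bool := (e.2 < e.1)%N && adj G e.1 e.2.

Definition outflow Q (k : 'I_V) : R := \sum_(l < V | adj G k l) Q k l.

Definition antisym Q : Prop := forall k l, adj G k l -> Q k l = - Q l k.

(** Conservation without a pressure potential: the competitors in Thomson's principle. The last
    clause keeps [Q ^+ 2 / kappa] meaningful under [0 / 0 = 0]. *)
Definition admissible_flow kappa Q : Prop :=
  [/\ antisym Q, forall k, k \notin Pset B -> outflow Q k = inflow B k &
      forall k l, adj G k l -> kappa k l = 0 -> Q k l = 0].

Lemma edge_adj e : edge e -> adj G e.1 e.2.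
Proof. by case/andP. Qed.

Lemma adjC k l : adj G k l = adj G l k.
Proof. exact: adj_sym. Qed.

Lemma edge_sum (F : 'I_V -> 'I_V -> R) :
  \sum_(k < V) \sum_(l < V | (l < k)%N && adj G k l) F k l =
  \sum_(e | edge e) F e.1 e.2.
Proof. by rewrite pair_big_dep. Qed.

Lemma edge_orientation (P : 'I_V -> 'I_V -> Prop) :
  (forall k l, adj G k l -> P k l -> P l k) ->
  (forall e, edge e -> P e.1 e.2) -> forall k l, adj G k l -> P k l.
Proof.
move=> Psym Pedge k l kl; case: (ltngtP k l) => [lt|gt|/val_inj eq].
- rewrite adjC in kl; apply: Psym => //.
  by apply: (Pedge (l, k)); rewrite /edge /= lt.
- by apply: (Pedge (k, l)); rewrite /edge /= gt.
- by move: kl; rewrite eq adj_irr.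
Qed.

(** Discrete Green identity: the double sum meets each edge in both orientations, and antisymmetry
    merges the two terms into a difference of [x]. *)
Lemma summation_by_parts x D : antisym D ->
  \sum_(k < V) x k * outflow D k =
  \sum_(e | edge e) (x e.1 - x e.2) * D e.1 e.2.
Proof.
move=> Da.
transitivity (\sum_(k < V) \sum_(l < V | adj G k l) x k * D k l).
  by apply: eq_bigr => k _; rewrite mulr_sumr.
transitivity (\sum_(k < V) \sum_(l < V | (l < k)%N && adj G k l) x k * D k l +
              \sum_(k < V) \sum_(l < V | (k < l)%N && adj G k l) x k * D k l).
  rewrite -big_split /=; apply: eq_bigr => k _.
  rewrite (bigID (fun l : 'I_V => (l < k)%N)) /=; congr (_ + _).
    by apply: eq_bigl => l; rewrite andbC.
  apply: eq_bigl => l; rewrite -leqNgt leq_eqVlt andbC andb_orl orbC.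
  case: eqP => [/val_inj ->|_] /=; last by rewrite orbF.
  by rewrite adj_irr andbF.
rewrite [X in _ + X](exchange_big_dep predT) //= -big_split /= -(edge_sum
  (fun k l => (x k - x l) * D k l)).
apply: eq_bigr => k _.
rewrite [X in _ + X](eq_bigl (fun l : 'I_V => (l < k)%N && adj G k l)); last first.
  by move=> l; rewrite adjC.
rewrite -big_split /=; apply: eq_bigr => l /andP[_ kl].
by rewrite (Da k l) //; ring.
Qed.

(** * Energy argument and uniqueness of the Kirchhoff flow *)

Lemma gradient_antisym kappa x : is_network G kappa ->
  antisym (fun k l => (x k - x l) * kappa k l).
Proof. by move=> net k l kl; rewrite (net k l kl).1 -mulNr opprB. Qed.

(** When the gradient flow is tested against [x] itself, every vertex term vanishes, so the
    nonnegative energies [kappa k l * (x k - x l) ^+ 2] sum to zero and each is zero. *)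
Lemma zero_energy kappa x : is_network G kappa ->
  (forall k, k \in Pset B -> x k = 0) ->
  (forall k, k \notin Pset B ->
     outflow (fun k l => (x k - x l) * kappa k l) k = 0) ->
  forall k l, adj G k l -> (x k - x l) * kappa k l = 0.
Proof.
move=> net xP xN.
have := summation_by_parts x (gradient_antisym x net).
rewrite big1 => [/esym E|k _]; last first.
  have [kP|kP] := boolP (k \in Pset B); first by rewrite xP // mul0r.
  by rewrite xN // mulr0.
apply: (@edge_orientation (fun k l => (x k - x l) * kappa k l = 0)) => [k l kl H|e ee].
  by rewrite -(net k l kl).1 -[_ - _]opprB mulNr H oppr0.
have nn f : edge f -> 0 <= (x f.1 - x f.2) * ((x f.1 - x f.2) * kappa f.1 f.2).
  move=> /edge_adj fa; rewrite mulrA -expr2 mulr_ge0 ?sqr_ge0 //.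
  by case: (net _ _ fa).
have /eqP := psumr_eq0P nn E ee; rewrite /= mulrA -expr2 mulf_eq0 sqrf_eq0 => /orP[] /eqP ->.
  by rewrite mul0r.
by rewrite mulr0.
Qed.

(** The difference of two pressure solutions vanishes on [Pset B] and has zero outflow elsewhere, so
    [zero_energy] applies. The pressures themselves may differ. *)
Lemma kirchhoff_flow_uniq kappa Q Q' : is_network G kappa ->
  kirchhoff_flow G B kappa Q -> kirchhoff_flow G B kappa Q' ->
  forall k l, adj G k l -> Q k l = Q' k l.
Proof.
move=> net [p [[pP pN] Qp]] [p' [[pP' pN'] Qp']] k l kl.
have dP i : i \in Pset B -> p i - p' i = 0 by move=> iP; rewrite pP // pP' // subrr.
have dN i : i \notin Pset B ->
    outflow (fun i j => ((p i - p' i) - (p j - p' j)) * kappa i j) i = 0.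
  move=> iP; transitivity (inflow B i - inflow B i); last by rewrite subrr.
  rewrite -{1}pN // -pN' // /outflow -sumrB; apply: eq_bigr => j _; ring.
have := zero_energy net dP dN kl; rewrite Qp // Qp' //; lra.
Qed.

(** * Existence of Kirchhoff flows by linear algebra *)

(** The weighted graph Laplacian with Dirichlet conditions: replacing both rows and columns of
    [Pset B] by those of the identity imposes the boundary values and keeps the matrix symmetric. *)
Definition grounded_laplacian kappa : 'M[R]_V :=
  \matrix_(i, j) if (i \in Pset B) || (j \in Pset B) then (i == j)%:R
    else (i == j)%:R * \sum_(l < V | adj G i l) kappa i l -
         (if adj G i j then kappa i j else 0).

Lemma grounded_laplacian_sym kappa : is_network G kappa ->
  forall i j, grounded_laplacian kappa i j = grounded_laplacian kappa j i.
Proof.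
move=> net i j; rewrite !mxE orbC (eq_sym j i); case: ifP => // _.
congr (_ - _); first by case: eqP => [->|_] //; rewrite !mul0r.
by rewrite (adjC j i); case: ifP => // /net[].
Qed.

Lemma grounded_laplacian_Pset kappa x i : i \in Pset B ->
  \sum_j grounded_laplacian kappa i j * x j = x i.
Proof.
move=> iP; rewrite (bigD1 i) //= mxE iP eqxx mul1r big1 ?addr0 // => j ji.
by rewrite mxE iP eq_sym (negbTE ji) /= mul0r.
Qed.

Lemma grounded_laplacianE kappa x i : i \notin Pset B ->
  (forall k, k \in Pset B -> x k = 0) ->
  \sum_j grounded_laplacian kappa i j * x j =
  outflow (fun k l => (x k - x l) * kappa k l) i.
Proof.
move=> iP xP.
transitivity (\sum_j ((i == j)%:R * (\sum_(l < V | adj G i l) kappa i l) * x j -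
         (if adj G i j then kappa i j * x j else 0))).
  apply: eq_bigr => j _; rewrite mxE (negbTE iP) /=.
  case: ifP => jP; first by rewrite xP // !mulr0 if_same subr0.
  by rewrite mulrBl; congr (_ - _); case: ifP; rewrite ?mul0r.
rewrite sumrB -big_mkcond /= (bigD1 i) //= eqxx mul1r [X in _ + X - _]big1 ?addr0.
  by rewrite mulr_suml -sumrB; apply: eq_bigr => l _; ring.
by move=> j ji; rewrite eq_sym (negbTE ji) !mul0r.
Qed.

(* The right-hand side is orthogonal to the kernel of the symmetric matrix
   [grounded_laplacian kappa], as witnessed by the admissible flow: kernel
   vectors are constant along the edges that carry flow. *)
Lemma kirchhoff_flow_exists kappa Q : is_network G kappa ->
  admissible_flow kappa Q -> exists Q', kirchhoff_flow G B kappa Q'.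
Proof.
move=> net [Qa QN Q0].
(* Prescribed pressures extended by zero. It remains to find a correction [x], zero on [Pset B],
   whose gradient flow has the outflow of the defect [D] elsewhere. *)
pose p0 i := if i \in Pset B then pbar B i else 0.
pose D i j := Q i j - (p0 i - p0 j) * kappa i j.
have Da : antisym D.
  move=> i j ij; rewrite /D (Qa i j ij) (gradient_antisym p0 net ij); ring.
pose b : 'rV[R]_V := \row_i if i \in Pset B then 0 else outflow D i.
pose A := grounded_laplacian kappa.
have /submxP[y yA] : (b <= A)%MS.
  rewrite submxE; apply/eqP/matrixP => z c; rewrite ord1 mxE [RHS]mxE {z}.
  pose v i := cokermx A i c.
  have Av i : \sum_j A i j * v j = 0.
    have := mulmx_coker A => /matrixP /(_ i c); by rewrite !mxE.
  have vP i : i \in Pset B -> v i = 0.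
    by move=> iP; rewrite -(grounded_laplacian_Pset kappa v iP) Av.
  have vN i : i \notin Pset B ->
      outflow (fun k l => (v k - v l) * kappa k l) i = 0.
    by move=> iP; rewrite -grounded_laplacianE.
  transitivity (\sum_i v i * outflow D i).
    apply: eq_bigr => i _; rewrite [b _ _]mxE -/(v i) mulrC.
    by case: ifP => // iP; rewrite vP // !mul0r.
  rewrite (summation_by_parts _ Da) big1 // => e /edge_adj ea.
  have /eqP := zero_energy net vP vN ea; rewrite mulf_eq0 => /orP[/eqP ->|/eqP k0]; first by rewrite mul0r.
  by rewrite /D k0 Q0 // mulr0 subr0 mulr0.
pose x i := y 0 i.
(* [submxP] gives a row solution [y *m A]; symmetry turns it into the column equation. *)
have Ax i : \sum_j A i j * x j = b 0 i.
  rewrite yA mxE; apply: eq_bigr => j _.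
  by rewrite mulrC /A grounded_laplacian_sym.
have xP i : i \in Pset B -> x i = 0.
  by move=> iP; rewrite -(grounded_laplacian_Pset kappa x iP) Ax mxE iP.
pose p i := p0 i + x i.
exists (fun k l => (p k - p l) * kappa k l), p; split => //; split=> [k kP|k kP].
  by rewrite /p /p0 kP xP // addr0.
have := Ax k; rewrite grounded_laplacianE // mxE (negbTE kP) => E.
transitivity (outflow (fun k l => (x k - x l) * kappa k l) k +
              (outflow Q k - outflow D k)); last by rewrite E QN //; ring.
rewrite /outflow -sumrB -big_split; apply: eq_bigr => l _; rewrite /D /p /=; ring.
Qed.

(** * Physical networks and Thomson's principle *)

(** Certifies a competitor as physical without computing its pressures. *)
Lemma physical_of_admissible kappa Q : is_network G kappa ->
  admissible_flow kappa Q -> physical G B kappa.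
Proof.
move=> net adm; split=> //; first exact: kirchhoff_flow_exists adm.
by move=> Q1 Q2; apply: kirchhoff_flow_uniq.
Qed.

Lemma kirchhoff_admissible kappa Q : is_network G kappa ->
  kirchhoff_flow G B kappa Q -> admissible_flow kappa Q.
Proof.
move=> net [p [[pP pN] Qp]]; split=> [k l kl|k kP|k l kl k0].
- have lk : adj G l k by rewrite adjC.
  by rewrite (Qp k l kl) (Qp l k lk) (gradient_antisym p net kl).
- by rewrite -pN //; apply: eq_bigr => l; apply: Qp.
- by rewrite Qp // k0 mulr0.
Qed.

(* Thomson's principle. *)
Lemma kirchhoff_flow_minimal kappa Q Q' : is_network G kappa ->
  kirchhoff_flow G B kappa Q -> admissible_flow kappa Q' ->
  complementary_dissipation G B kappa Q <= complementary_dissipation G B kappa Q'.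
Proof.
move=> net flow [Qa' QN' Q0'].
have [Qa QN Q0] := kirchhoff_admissible net flow.
have [p [[pP pN] Qp]] := flow.
pose D k l := Q' k l - Q k l.
have Da : antisym D by move=> k l kl; rewrite /D Qa' // Qa //; ring.
have oD k : outflow D k = outflow Q' k - outflow Q k by rewrite /outflow -sumrB.
(* As [p] is the prescribed pressure on [Pset B] and [D] has no outflow elsewhere, the change of the
   pressure term is the cross term of the quadratic form. *)
have E : \sum_(k in Pset B) pbar B k * outflow Q' k -
         \sum_(k in Pset B) pbar B k * outflow Q k =
         \sum_(e | edge e) (p e.1 - p e.2) * D e.1 e.2.
  rewrite -(summation_by_parts p Da) -sumrB [RHS](bigID (mem (Pset B))) /=.
  rewrite [X in _ + X]big1 ?addr0; last first.
    by move=> k kP; rewrite oD QN // QN' // subrr mulr0.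
  by apply: eq_bigr => k kP; rewrite oD pP // mulrBr.
rewrite /complementary_dissipation !edge_sum.
rewrite -[\sum_(k in Pset B) _ * (\sum_(l < V | adj G k l) Q k l)]
          /(\sum_(k in Pset B) pbar B k * outflow Q k).
rewrite -[\sum_(k in Pset B) _ * (\sum_(l < V | adj G k l) Q' k l)]
          /(\sum_(k in Pset B) pbar B k * outflow Q' k).
suff : \sum_(e | edge e) (Q e.1 e.2 ^+ 2 / kappa e.1 e.2 +
         2 * ((p e.1 - p e.2) * D e.1 e.2)) <=
       \sum_(e | edge e) Q' e.1 e.2 ^+ 2 / kappa e.1 e.2.
  rewrite big_split /= -mulr_sumr -E; lra.
apply: ler_sum => e /edge_adj ea.
have [k0|k0] := eqVneq (kappa e.1 e.2) 0.
  by rewrite /D k0 Q0' // Q0 // subrr !mulr0 invr0 !mulr0 addr0.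
have kpos : 0 < kappa e.1 e.2.
  by rewrite lt_neqAle eq_sym k0; case: (net _ _ ea).
have -> : Q' e.1 e.2 = Q e.1 e.2 + D e.1 e.2 by rewrite /D addrC subrK.
rewrite (Qp _ _ ea) -subr_ge0.
(* Completing the square: the edgewise gap is the energy of [D]. *)
rewrite [X in 0 <= X](_ : _ = D e.1 e.2 ^+ 2 / kappa e.1 e.2); last by field.
by rewrite divr_ge0 ?sqr_ge0 ?ltW.
Qed.

(** * Consequences of global optimality *)

Lemma complementary_dissipationE kappa Q :
  complementary_dissipation G B kappa Q =
  \sum_(e | edge e) Q e.1 e.2 ^+ 2 / kappa e.1 e.2 -
  2 * \sum_(k in Pset B) pbar B k * outflow Q k.
Proof. by rewrite /complementary_dissipation edge_sum. Qed.

(* Scaling [r] up to use all the material only lowers the dissipation, and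
   [Q'] dissipates at least as much as the Kirchhoff flow. *)
Lemma minimizer_le_rescaled K kappa Q Q' (r : 'I_V -> 'I_V -> R) :
  global_minimizer G B K kappa -> kirchhoff_flow G B kappa Q ->
  admissible_flow kappa Q' ->
  (forall k l, adj G k l -> r k l = r l k) ->
  (forall k l, adj G k l -> 0 < r k l) ->
  0 < \sum_(e | edge e) Num.sqrt (kappa e.1 e.2) * weight G e.1 e.2 * r e.1 e.2
    <= K ->
  complementary_dissipation G B kappa Q <=
  \sum_(e | edge e) Q' e.1 e.2 ^+ 2 / kappa e.1 e.2 / r e.1 e.2 ^+ 2 -
  2 * \sum_(k in Pset B) pbar B k * outflow Q' k.
Proof.
move=> [[net _ _] _ opt] flow [Qa QN Q0] rsym rpos.
set W := (\sum_(e | edge e) _ in X in 0 < X <= _) => /andP[W0 WK].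
pose s := K / W.
have s1 : 1 <= s by rewrite ler_pdivlMr // mul1r.
(* Material is linear in the square root of conductance, so this multiplies the material of an edge
   by [s * r k l]. *)
pose kappa' k l := kappa k l * (s * r k l) ^+ 2.
have sr k l : adj G k l -> 0 < s * r k l.
  by move=> kl; rewrite mulr_gt0 ?rpos //; lra.
have net' : is_network G kappa'.
  move=> k l kl; have [ks k0] := net k l kl.
  by rewrite /kappa' ks rsym // -ks mulr_ge0 ?sqr_ge0.
have adm' : admissible_flow kappa' Q'.
  split=> // k l kl /eqP; rewrite /kappa' mulf_eq0 sqrf_eq0 => /orP[/eqP k0|].
    exact: Q0.
  by rewrite gt_eqF ?sr.
have mat' : material G kappa' = K.
  rewrite /material edge_sum.
  transitivity (\sum_(e | edge e) s *
    (Num.sqrt (kappa e.1 e.2) * weight G e.1 e.2 * r e.1 e.2)).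
    apply: eq_bigr => e /edge_adj ea; rewrite /kappa' sqrtrM; last first.
      by case: (net _ _ ea).
    by rewrite sqrtr_sqr gtr0_norm ?sr //; ring.
  by rewrite -mulr_sumr -/W /s divfK // gt_eqF.
have phys' := physical_of_admissible net' adm'.
have [Q'' flow''] : exists Q, kirchhoff_flow G B kappa' Q by case: phys'.
apply: (le_trans (opt _ _ _ phys' mat' flow flow'')).
apply: (le_trans (kirchhoff_flow_minimal net' flow'' adm')).
rewrite complementary_dissipationE lerD2r; apply: ler_sum => e /edge_adj ea.
have [_ k0] := net _ _ ea; have r0 := rpos _ _ ea.
rewrite /kappa' -mulrA; apply: ler_wpM2l; first exact: sqr_ge0.
rewrite invfM; apply: ler_wpM2l; first by rewrite invr_ge0.
rewrite lef_pV2 ?posrE ?exprn_gt0 ?sr // ler_pXn2r ?nnegrE ?(ltW r0) ?(ltW (sr _ _ ea)) //.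
by rewrite ler_peMl // ltW.
Qed.

(** The Lagrange condition for the material constraint: [optimal_allocation] is applied with the
    flow [Q] kept fixed. Its factors depend only on the symmetric ratio [g / w], hence give
    symmetric rescalings. *)
Lemma minimizer_dissipation K kappa Q : 0 < K ->
  global_minimizer G B K kappa -> kirchhoff_flow G B kappa Q ->
  exists lam : R, forall k l, adj G k l ->
    Q k l ^+ 2 / kappa k l = lam * (Num.sqrt (kappa k l) * weight G k l).
Proof.
move=> K0 kmin flow; have [[net _ _] mat _] := kmin.
have adm := kirchhoff_admissible net flow; have [Qa QN Q0] := adm.
pose w k l := Num.sqrt (kappa k l) * weight G k l.
pose g k l := Q k l ^+ 2 / kappa k l.
have wsym k l : adj G k l -> w k l = w l k.
  by move=> kl; rewrite /w (net k l kl).1 weight_sym.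
have gsym k l : adj G k l -> g k l = g l k.
  by move=> kl; rewrite /g (net k l kl).1 Qa // sqrrN.
have w0 k l : adj G k l -> 0 <= w k l.
  by move=> kl; rewrite mulr_ge0 ?sqrtr_ge0 // ltW ?weight_gt0.
have WK : \sum_(e | edge e) w e.1 e.2 = K by rewrite -mat /material edge_sum.
have [] := @optimal_allocation _ _ edge (fun e => w e.1 e.2) (fun e => g e.1 e.2).
- by move=> e /edge_adj /w0.
- by move=> e /edge_adj ea; rewrite divr_ge0 ?sqr_ge0 //; case: (net _ _ ea).
- move=> e /edge_adj ea /eqP; rewrite mulf_eq0 sqrtr_eq0 => /orP[k0|]; last first.
    by rewrite gt_eqF ?weight_gt0.
  by rewrite /g Q0 ?expr0n ?mul0r //; apply/eqP; rewrite eq_le k0; case: (net _ _ ea).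
- by rewrite WK.
- move=> phi phipos cost.
  have rsym k l : adj G k l -> phi (g k l / w k l) = phi (g l k / w l k).
    by move=> kl; rewrite gsym // wsym.
  have rpos : forall k l, adj G k l -> 0 < phi (g k l / w k l).
    by apply: edge_orientation => [k l kl|e /phipos //]; rewrite rsym.
  have := minimizer_le_rescaled kmin flow adm rsym rpos.
  rewrite cost WK K0 lexx => /(_ isT).
  by rewrite complementary_dissipationE lerD2r.
move=> lam gw; exists lam.
apply: (@edge_orientation (fun k l => g k l = lam * w k l)) => // k l kl.
by rewrite gsym // wsym.
Qed.

(** * Rerouting flow along a path *)

(** Each step of the path adds one unit from [k] to [m]; sources and sinks at intermediate vertices
    telescope. *)
Lemma path_flow (e : rel 'I_V) k s : subrel e (adj G) -> symmetric e ->
  path e k s -> exists S : 'I_V -> 'I_V -> R,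
  [/\ forall i j, S i j = - S j i, forall i j, ~~ e i j -> S i j = 0 &
      forall i, outflow S i = (i == k)%:R - (i == last k s)%:R].
Proof.
move=> sub esym; elim: s k => [|m s IH] k /=.
  move=> _; exists (fun _ _ => 0); split=> // i; first by rewrite oppr0.
  by rewrite /outflow big1 // subrr.
move=> /andP[km /IH[S [Sa S0 So]]].
pose E i j : R := (i == k)%:R * (j == m)%:R.
exists (fun i j => E i j - E j i + S i j); split=> [i j|i j ij|i].
- by rewrite (Sa i j); ring.
- rewrite S0 // addr0 /E.
  have -> : (i == k)%:R * (j == m)%:R = 0 :> R.
    case: eqP ij => [->|]; last by rewrite mul0r.
    by case: eqP => [->|]; rewrite ?mulr0 // km.
  have -> : (j == k)%:R * (i == m)%:R = 0 :> R; last by rewrite subrr.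
  case: (j =P k) ij => [->|]; last by rewrite mul0r.
  by case: (i =P m) => [->|]; rewrite ?mulr0 // esym km.
have row a b : adj G a b ->
    \sum_(j < V | adj G i j) (i == a)%:R * (j == b)%:R = (i == a)%:R :> R.
  move=> ab; case: eqP => [->|_]; last by rewrite big1 // => j _; rewrite mul0r.
  rewrite (bigD1 b) //= eqxx mulr1 big1 ?addr0 // => j /andP[_ /negbTE ->].
  by rewrite mulr0.
rewrite /outflow big_split /= -/(outflow S i) So sumrB /E row ?sub //.
rewrite (eq_bigr (fun j => (i == m)%:R * (j == k)%:R)) => [|j _]; last exact: mulrC.
by rewrite row; [ring | rewrite adjC sub].
Qed.

End Network.

Theorem theorem3p7 (R : realType) (V : nat) (G : prior_network R V)
    (B : boundary_conditions R V) (K : R) (K_gt0 : 0 < K)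
    (kappa Q : 'I_V -> 'I_V -> R)
    (kappa_min : global_minimizer G B K kappa)
    (Q_flow : kirchhoff_flow G B kappa Q)
    (Q_neq0 : ~ (forall k l : 'I_V, adj G k l -> Q k l = 0)) :
  ~ (exists k k' : 'I_V,
       [/\ k \in Pset B, k' \in Pset B, k != k', pbar B k = pbar B k' &
           exists s : seq 'I_V, connecting_path G kappa k k' s]).
Proof.
case=> k [k' [kP k'P kk' pkk' [s [ks lks _]]]].
have [[net _ _] mat _] := kappa_min.
have [Qa QN Q0] := kirchhoff_admissible net Q_flow.
have [lam gw] := minimizer_dissipation K_gt0 kappa_min Q_flow.
pose w i j := Num.sqrt (kappa i j) * weight G i j.
have WK : \sum_(e | edge G e) w e.1 e.2 = K by rewrite -mat /material edge_sum.
have wpos i j : adj G i j -> kappa i j != 0 -> 0 < w i j.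
  move=> ij k0; rewrite mulr_gt0 ?weight_gt0 // sqrtr_gt0 lt_neqAle eq_sym k0.
  by case: (net i j ij).
have w0 i j : adj G i j -> 0 <= w i j.
  by move=> ij; rewrite mulr_ge0 ?sqrtr_ge0 // ltW ?weight_gt0.
(* [lam * K] is the total dissipation, hence nonnegative; [lam = 0] would force [Q = 0] on every
   edge. *)
have lam0 : 0 < lam.
  have lamne : lam != 0.
    apply/eqP => lam0; apply: Q_neq0 => i j ij.
    have [k0|k0] := eqVneq (kappa i j) 0; first exact: Q0.
    have /eqP := gw i j ij; rewrite lam0 mul0r mulf_eq0 invr_eq0 (negbTE k0) orbF.
    by rewrite sqrf_eq0 => /eqP.
  have : 0 <= lam * K.
    rewrite -WK mulr_sumr; apply: sumr_ge0 => e /edge_adj ea.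
    by rewrite -gw // divr_ge0 ?sqr_ge0 //; case: (net _ _ ea).
  by rewrite pmulr_lge0 // lt_neqAle eq_sym lamne.
have Qne0 i j : adj G i j -> kappa i j != 0 -> Q i j != 0.
  move=> ij k0; apply/eqP => Qij0; have := gw i j ij.
  rewrite Qij0 expr0n mul0r => /esym/eqP; apply/negP.
  by rewrite mulf_neq0 ?(gt_eqF (wpos _ _ _ _)) // gt_eqF.
pose E i j := adj G i j && (0 < kappa i j).
have Esym : symmetric E.
  move=> i j; rewrite /E (adjC G j i); case: (boolP (adj G i j)) => //= ij.
  by rewrite (net i j ij).1.
have Esub : subrel E (adj G) by move=> i j /andP[].
have [S [Sa S0 So]] := path_flow Esub Esym ks.
have Sk0 i j : adj G i j -> kappa i j = 0 -> S i j = 0.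
  by move=> ij k0; rewrite S0 // /E k0 ltxx andbF.
(* The relative change of flow: [Q] is nonzero on conducting edges, and on the other edges this is
   [0 / 0 = 0]. *)
pose t0 i j := S i j / Q i j.
have t0sym i j : adj G i j -> t0 i j = t0 j i.
  by move=> ij; rewrite /t0 Sa Qa // invrN mulrNN.
have t0Q i j : adj G i j -> Q i j * t0 i j = S i j.
  move=> ij; rewrite /t0 mulrC; have [k0|k0] := eqVneq (kappa i j) 0.
    by rewrite Sk0 // !mul0r.
  by rewrite divfK ?Qne0.
pose eps0 : R := if \sum_(e | edge G e) w e.1 e.2 * t0 e.1 e.2 <= 0 then 1 else -1.
have eps0sqr : eps0 ^+ 2 = 1 by rewrite /eps0; case: ifP => _; rewrite ?sqrrN expr1n.
(* [h] brings every [|t|] to at most 1, the range of [perturbation_gain]; [eps] is [h * eps0]. *)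
have [h [h0 _ ht]] := small_multiplier (edge G) (fun e => eps0 * t0 e.1 e.2) 0.
pose t i j := h * (eps0 * t0 i j).
have tsym i j : adj G i j -> t i j = t j i by move=> ij; rewrite /t t0sym.
have tb : forall i j, adj G i j -> `|t i j| <= 1.
  by apply: edge_orientation => [i j ij|e /ht //]; rewrite tsym.
pose a := \sum_(e | edge G e) w e.1 e.2 * t e.1 e.2.
have a0 : a <= 0.
  have -> : a = h * (eps0 * \sum_(e | edge G e) w e.1 e.2 * t0 e.1 e.2).
    by rewrite !mulr_sumr; apply: eq_bigr => e _; rewrite /t; ring.
  rewrite pmulr_rle0 // /eps0; case: ifPn => [H|]; first by rewrite mul1r.
  by rewrite -ltNge => H; lra.
pose b := \sum_(e | edge G e) w e.1 e.2 * t e.1 e.2 ^+ 2.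
have wt0 e : edge G e -> 0 <= w e.1 e.2 * t e.1 e.2 ^+ 2.
  by move=> /edge_adj ea; rewrite mulr_ge0 ?w0 ?sqr_ge0.
(* If [b = 0], then [S] vanishes on every edge, contradicting its unit outflow at [k], which is not
   cancelled since [k != k']. *)
have b0 : 0 < b.
  rewrite lt_neqAle sumr_ge0 // andbT eq_sym; apply/eqP => b0.
  have Sz : forall i j, adj G i j -> S i j = 0.
    apply: (@edge_orientation _ _ _ (fun i j => S i j = 0)) => [i j ij H|e ee].
      by rewrite Sa H oppr0.
    have ea := edge_adj ee.
    have /eqP := psumr_eq0P wt0 b0 ee; rewrite mulf_eq0 => /orP[we0|].
      apply: Sk0 => //; apply/eqP; apply: contraTT we0 => k0.
      by rewrite gt_eqF ?wpos.
    rewrite sqrf_eq0 !mulf_eq0 (gt_eqF h0) -sqrf_eq0 eps0sqr oner_eq0 /=.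
    by rewrite -mulf_eq0 => /eqP t00; rewrite -t0Q // /t0 t00 mulr0.
  have := So k; rewrite /outflow big1 => [|j]; last exact: Sz.
  rewrite lks eqxx (negbTE kk') subr0 => /esym/eqP; by rewrite oner_eq0.
pose Q' i j := Q i j + h * eps0 * S i j.
have oQ' i : outflow G Q' i = outflow G Q i + h * eps0 * outflow G S i.
  by rewrite /outflow mulr_sumr -big_split.
have adm' : admissible_flow G B kappa Q'.
  split=> [i j ij|i iP|i j ij k0]; first by rewrite /Q' Qa // Sa; ring.
    rewrite oQ' QN // So lks.
    have [/negbTE -> /negbTE ->] : i != k /\ i != k'.
      by split; apply: contraNneq iP => ->.
    by rewrite subrr mulr0 addr0.
  by rewrite /Q' Q0 // Sk0 // mulr0 addr0.
pose r i j := 1 + 2 / 3 * t i j.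
have rsym i j : adj G i j -> r i j = r j i by move=> ij; rewrite /r tsym.
have rge i j : adj G i j -> 1 / 3 <= r i j.
  by move=> /tb; rewrite ler_norml /r => /andP[]; lra.
have rpos i j : adj G i j -> 0 < r i j by move=> /rge; lra.
have cost : \sum_(e | edge G e) w e.1 e.2 * r e.1 e.2 = K + 2 / 3 * a.
  by rewrite -WK /a mulr_sumr -big_split; apply: eq_bigr => e _; rewrite /r /=; ring.
have costb : 0 < \sum_(e | edge G e) w e.1 e.2 * r e.1 e.2 <= K.
  apply/andP; split; last by rewrite cost; lra.
  apply: (@lt_le_trans _ _ (1 / 3 * K)); first by rewrite mulr_gt0 //; lra.
  rewrite -WK mulr_sumr; apply: ler_sum => e /edge_adj ea.
  by rewrite mulrC ler_wpM2l ?w0 ?rge.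
have := minimizer_le_rescaled kappa_min Q_flow adm' rsym rpos costb.
(* The outflow changes at [k] and [k'] are opposite and weighted by equal pressures. *)
have -> : \sum_(i in Pset B) pbar B i * outflow G Q' i =
          \sum_(i in Pset B) pbar B i * outflow G Q i.
  transitivity (\sum_(i in Pset B) (pbar B i * outflow G Q i + h * eps0 *
     (pbar B i * (i == k)%:R - pbar B i * (i == k')%:R))).
    by apply: eq_bigr => i _; rewrite oQ' So lks; ring.
  have pick j : j \in Pset B ->
      \sum_(i in Pset B) pbar B i * (i == j)%:R = pbar B j.
    move=> jP; rewrite (bigD1 j) //= eqxx mulr1 big1 ?addr0 // => i /andP[_].
    by move/negbTE ->; rewrite mulr0.
  by rewrite big_split /= -mulr_sumr sumrB !pick // pkk' subrr mulr0 addr0.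
rewrite complementary_dissipationE lerD2r; apply/negP; rewrite -ltNge.
(* The rescaled dissipation is at most [lam * (K + 2 / 3 * a - 1 / 6 * b)], below [lam * K] since
   [a <= 0 < b]. *)
apply: (@le_lt_trans _ _ (\sum_(e | edge G e) lam * (w e.1 e.2 +
    2 / 3 * (w e.1 e.2 * t e.1 e.2) - 1 / 6 * (w e.1 e.2 * t e.1 e.2 ^+ 2)))).
  apply: ler_sum => e /edge_adj ea.
  have -> : Q' e.1 e.2 = Q e.1 e.2 * (1 + t e.1 e.2).
    by rewrite /Q' -t0Q // /t; ring.
  have -> : (Q e.1 e.2 * (1 + t e.1 e.2)) ^+ 2 / kappa e.1 e.2 / r e.1 e.2 ^+ 2 =
      lam * w e.1 e.2 * ((1 + t e.1 e.2) ^+ 2 / r e.1 e.2 ^+ 2).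
    by rewrite /w -gw // exprMn; ring.
  have := perturbation_gain (tb _ _ ea).
  move=> /(ler_wpM2l (mulr_ge0 (ltW lam0) (w0 _ _ ea))) /le_trans; apply.
  by rewrite -subr_ge0 [X in 0 <= X](_ : _ = 0) //; ring.
rewrite -mulr_sumr sumrB big_split /= -!mulr_sumr -/a -/b WK.
have -> : \sum_(e | edge G e) Q e.1 e.2 ^+ 2 / kappa e.1 e.2 = lam * K.
  by rewrite -WK mulr_sumr; apply: eq_bigr => e /edge_adj ea; rewrite gw.
by rewrite ltr_pM2l //; lra.
Qed.
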